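(* Let $M\in\mathbb{N}$, $\mathcal{I}=\{1,\dots,M\}$, and consider $\mathcal{A}=\{A_1,\dots,A_M\}\subset\mathbb{R}^{n\times n}$ and $\tau_2\ge\tau_1\ge0$. Then $\rho=\rho_{\mathcal{S}_{\mathrm{dw}}(\tau_1,\tau_2)}(\mathcal{A})$ is the $\mathcal{S}_{\mathrm{dw}}(\tau_1,\tau_2)$-exponential decay rate of the switched linear system $\dot x(t)=A_{\sigma(t)}x(t)$ if and only if for all $\alpha<\rho$ there exist norms $v_i^-,v_i^+:\mathbb{R}^n\to\mathbb{R}$, $i\in\mathcal{I}$, such that $$v_i^+(e^{A_it}x)\le e^{-\alpha t}v_i^-(x)\quad\forall i\in\mathcal{I},\ \forall t\in[0,\tau_2-\tau_1],\ \forall x\in\mathbb{R}^n,$$ $$v_j^-(e^{A_i\tau_1}x)\le e^{-\alpha\tau_1}v_i^+(x)\quad\forall i\ne j\in\mathcal{I},\ \forall x\in\mathbb{R}^n.$$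
   Context: $\mathbb{R}_+=[0,\infty)$ and $|\cdot|$ is the norm on $\mathbb{R}^n$. $\mathcal{S}$ is the set of piecewise constant, right-continuous signals $\sigma:\mathbb{R}_+\to\mathcal{I}$. For $\sigma\in\mathcal{S}$, $\{t_k^\sigma\}$ denotes the sequence of switching instants, i.e. the points at which $\sigma$ is discontinuous, together with the initial instant $t_0^\sigma:=0$. The set $\{t_k^\sigma\}$ may be infinite or finite, possibly reduced to the initial instant; if it is infinite, it is unbounded. The class of signals with lower and upper dwell-time bounds $\tau_1,\tau_2$ is $$\mathcal{S}_{\mathrm{dw}}(\tau_1,\tau_2)=\{\sigma\in\mathcal{S}\mid \tau_1\le t_k^\sigma-t_{k-1}^\sigma\le\tau_2\ \ \forall\, t_k^\sigma>0\}.$$ For $\sigma\in\mathcal{S}$, $\Phi_\sigma(t,x)$ denotes the solution of $\dot x(t)=A_{\sigma(t)}x(t)$ starting at $x\in\mathbb{R}^n$ at time $0$, evaluated at time $t$. For $\widetilde{\mathcal{S}}\subseteq\mathcal{S}$, the system is uniformly exponentially stable with decay $\rho>0$ on $\widetilde{\mathcal{S}}$ if there exists $C\ge0$ such that $|\Phi_\sigma(t,x)|\le Ce^{-\rho t}|x|$ for all $\sigma\in\widetilde{\mathcal{S}}$, all $x\in\mathbb{R}^n$ and all $t\in\mathbb{R}_+$. The $\widetilde{\mathcal{S}}$-exponential decay rate $\rho_{\widetilde{\mathcal{S}}}(\mathcal{A})$ is the supremum over the $\rho>0$ for which this estimate is satisfied for some $C\ge0$.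
   Formalization: The formal version takes ρ>0 (possibly +∞), adds that ρ is the largest value with the norm property (which every smaller ρ also has), and applies the upper dwell bound to the last interval too, excluding signals with finitely many switchings, for which the claim fails. *)

(* Defs.v *)
(* MathComp-Analysis. *)
From mathcomp Require Import all_boot all_order all_algebra.
From mathcomp Require Import all_classical all_reals all_analysis.

Set Implicit Arguments.
Unset Strict Implicit.
Unset Printing Implicit Defensive.

Import Order.TTheory GRing.Theory Num.Theory.
Import numFieldNormedType.Exports.

Local Open Scope classical_set_scope.
Local Open Scope ring_scope.

Definition is_norm (R : realType) (V : lmodType R) (v : V -> R) : Prop :=
  [/\ forall x y, v (x + y) <= v x + v y,
      forall (a : R) x, v (a *: x) = `|a| * v x
    & forall x, v x = 0 -> x = 0].

(* The limit is taken in the normed space of matrices. *)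
Definition expmx (R : realType) (n : nat) (B : 'M[R]_n) : 'M[R]_n :=
  limn (series (fun k : nat => (k`!%:R)^-1 *: B ^+ k)).

Section Signals.
Context (R : realType) (M : nat).

(* A signal on [0, +oo[ is a total function on R of which only the values at
   nonnegative times are used; continuity is for the discrete topology on
   'I_M.  At time 0 right-continuity is continuity on [0, +oo[, so that the
   discontinuities are positive. *)
Definition discontinuities (sigma : R -> 'I_M) : set R :=
  [set t : R | 0 < t /\ ~ \forall s \near t, sigma s = sigma t].

(* Right-continuity together with local finiteness of the discontinuities
   makes sigma constant on each interval [t_k, t_(k+1)[ between consecutive
   switching instants. *)
Definition is_signal (sigma : R -> 'I_M) : Prop :=
  (forall t : R, 0 <= t -> \forall s \near t^'+, sigma s = sigma t) /\
  (forall T : R, finite_set (discontinuities sigma `&` `[0, T])).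

(* The first switching instant after t_k; since ereal_inf set0 = +oo, a signal
   with only finitely many switching instants has t_k = +oo past the last. *)
Fixpoint switching_instant (sigma : R -> 'I_M) (k : nat) : \bar R :=
  if k is k'.+1 then
    ereal_inf [set s%:E | s in
      [set s | discontinuities sigma s /\
               (switching_instant sigma k' < s%:E)%E]]
  else 0%:E.

(* The bounds constrain every activation interval, including a last one of
   infinite length: as tau2 is finite, signals that eventually stop switching
   (constant ones in particular) are excluded.  They have to be: with two
   scalar modes A_1 = 1, A_2 = -3 and tau1 = tau2 = 1, the signals that switch
   forever decay at rate 1, whereas the constant signal 1 gives e^t. *)
Definition dwell_signals (tau1 tau2 : R) : set (R -> 'I_M) :=
  [set sigma | is_signal sigma /\
    forall k,
      (tau1%:E <= switching_instant sigma k.+1 - switching_instant sigma k /\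
       switching_instant sigma k.+1 - switching_instant sigma k <= tau2%:E)%E].

End Signals.

Section DecayRate.
Context (R : realType) (n M : nat).

(* phi is t |-> Phi_sigma(t, x): continuous on [0, +oo[, with the differential
   equation holding at every positive time that is not a switching instant. *)
Definition is_solution (A : 'I_M -> 'M[R]_n) (sigma : R -> 'I_M)
    (x : 'cV[R]_n) (phi : R -> 'cV[R]_n) : Prop :=
  [/\ phi 0 = x,
      {within `[0, +oo[, continuous phi}
    & forall t : R, 0 < t -> ~ discontinuities sigma t ->
        is_derive t 1 phi (A (sigma t) *m phi t)].

Definition exp_stable_with_decay (nrm : 'cV[R]_n -> R) (A : 'I_M -> 'M[R]_n)
    (S : set (R -> 'I_M)) (rho : R) : Prop :=
  exists2 C : R, 0 <= C &
    forall sigma x phi t, S sigma -> is_solution A sigma x phi -> 0 <= t ->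
      nrm (phi t) <= C * expR (- rho * t) * nrm x.

(* Equal to -oo when the system is not exponentially stable on S, and to +oo
   when every decay is admissible. *)
Definition exp_decay_rate (nrm : 'cV[R]_n -> R) (A : 'I_M -> 'M[R]_n)
    (S : set (R -> 'I_M)) : \bar R :=
  ereal_sup [set rho%:E | rho in
    [set rho : R | 0 < rho /\ exp_stable_with_decay nrm A S rho]].

Definition has_dwell_norms (A : 'I_M -> 'M[R]_n) (tau1 tau2 alpha : R) : Prop :=
  exists vm vp : 'I_M -> 'cV[R]_n -> R,
    [/\ forall i, is_norm (vm i) /\ is_norm (vp i),
        forall i t x, 0 <= t <= tau2 - tau1 ->
          vp i (expmx (t *: A i) *m x) <= expR (- alpha * t) * vm i x
      & forall i j x, i != j ->
          vm j (expmx (tau1 *: A i) *m x) <= expR (- alpha * tau1) * vp i x].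

End DecayRate.

(* Main.v *)
Require Import Defs.
From mathcomp Require Import all_boot all_order all_algebra.
From mathcomp Require Import all_classical all_reals all_analysis.
From mathcomp Require Import ring lra.

(** The theorem equates two suprema: that of the decays [rho] for which the
estimate holds on all dwell-time signals, and that of the [alpha] for which
suitable norms exist. It is enough that norms for [alpha] give the estimate
with decay [alpha], and that the estimate with decay [rho] gives norms for
every [alpha <= rho].

From norms to stability ([dwell_norms_stable]): the switching instants of a
signal with bounded dwell times form an unbounded sequence ([dwell_follows]),
and between two consecutive ones the solution is a matrix exponential applied
to the state at the former ([solution_step]). At switching instants, [v_i^-] of the
active mode [i] decreases at rate [alpha], because a dwell time in
[[tau1, tau2]] is a free part in [[0, tau2 - tau1]] followed by [tau1]. The
equivalence of norms in finite dimension ([is_norm_equiv]) turns this into the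
estimate.

From stability to norms ([stable_dwell_norms]): let [v_i^-(x)] and [v_i^+(x)]
be the suprema of [e^(alpha t) |B x|] over the transition matrices [B] of
duration [t] of finite schedules that start in mode [i], at its entry and
after the free part of its dwell time respectively. Such suprema are norms as
soon as they are finite, and they satisfy both families of inequalities since
a step followed by a schedule is a schedule. They are finite because every
schedule is the beginning of a dwell-time signal, to which the estimate
applies ([schedule_bounded]), except when there is a single mode or
[tau2 = 0]: schedules are then too short to grow. When [tau1 = 0] a schedule may contain
activations of zero duration, which no signal has; a limit of signals with
short activations takes care of them ([realized_bounded]). *)

Set Implicit Arguments.
Unset Strict Implicit.
Unset Printing Implicit Defensive.

Import Order.TTheory GRing.Theory Num.Theory.
Import numFieldNormedType.Exports.

Local Open Scope classical_set_scope.
Local Open Scope ring_scope.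

(** * Matrix-valued functions of a real variable *)

Lemma mx_entry_le_norm (R : realType) p q (B : 'M[R]_(p, q)) i j :
  `|B i j| <= `|B|.
Proof.
rewrite [leRHS]/Num.Def.normr/= mx_normrE.
exact: (le_bigmax _ (fun ij : 'I_p * 'I_q => `|B ij.1 ij.2|) (i, j)).
Qed.

Lemma cvg_mxP (R : realType) p q (T : Type) (F : set_system T) {FF : Filter F}
    (f : T -> 'M[R]_(p, q)) (B : 'M[R]_(p, q)) :
  f x @[x --> F] --> B <-> forall i j, f x i j @[x --> F] --> B i j.
Proof.
split=> [fB i j|fB].
  exact: (cvg_comp _ _ fB (@coord_continuous _ _ _ i j B)).
apply/cvgrPdist_le => e e0; near=> x.
rewrite [leLHS]/Num.Def.normr/= mx_normrE (bigmax_le _ (ltW e0))// => ij _.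
rewrite !mxE; move: ij; near: x; apply: filter_forall => ij.
exact: ((cvgrPdist_le _ _).1 (fB ij.1 ij.2) _ e0).
Unshelve. all: by end_near. Qed.

Lemma cvg_mulmx (R : realType) p q r (T : Type) (F : set_system T)
    {FF : Filter F} (f : T -> 'M[R]_(p, q)) (g : T -> 'M[R]_(q, r))
    (B : 'M[R]_(p, q)) (C : 'M[R]_(q, r)) :
  f x @[x --> F] --> B -> g x @[x --> F] --> C ->
  (f x *m g x) @[x --> F] --> B *m C.
Proof.
move=> /cvg_mxP fB /cvg_mxP gC; apply/cvg_mxP => i j; rewrite mxE.
under eq_cvg do rewrite mxE.
by apply: cvg_big => [|k _]; [exact: add_continuous|exact: cvgM].
Unshelve. all: by end_near. Qed.

Lemma is_derive_mxP (R : realType) p q (f : R -> 'M[R]_(p, q)) (t : R) D :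
  is_derive t 1 f D <-> forall i j, is_derive t 1 (fun s => f s i j) (D i j).
Proof.
split=> [[fd <-] i j|fD].
  have /derivable_mxP/(_ i j) fij := fd.
  by apply: DeriveDef => //; rewrite derive_mx// mxE.
have fd : derivable f t 1 by apply/derivable_mxP => i j; case: (fD i j).
apply: DeriveDef => //; rewrite derive_mx//; apply/matrixP => i j.
by rewrite mxE; case: (fD i j).
Qed.

Lemma is_derive_mulmx (R : realType) p q r (f : R -> 'M[R]_(p, q))
    (g : R -> 'M[R]_(q, r)) (t : R) Df Dg :
  is_derive t 1 f Df -> is_derive t 1 g Dg ->
  is_derive t 1 (fun s => f s *m g s) (Df *m g t + f t *m Dg).
Proof.
move=> /is_derive_mxP fD /is_derive_mxP gD; apply/is_derive_mxP => i j.
have E : (fun s => (f s *m g s) i j) =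
    \sum_k ((fun s => f s i k) * (fun s => g s k j)).
  by apply/funext => s; rewrite mxE fct_sumE.
rewrite E; apply: is_derive_eq.
rewrite !mxE -big_split/=; apply: eq_bigr => k _.
by rewrite /GRing.scale/= mulrC addrC (mulrC (g t k j)) mulrC.
Qed.

(** * The matrix exponential *)

(** The maximum norm of matrices is not submultiplicative; the factor n
makes up for that. *)
Lemma expr_mx_entry_le (R : realType) n (B : 'M[R]_n) k i j :
  `|(B ^+ k) i j| <= (n%:R * `|B|) ^+ k.
Proof.
elim: k i j => [|k IH] i j.
  by rewrite !expr0 mxE; case: eqP => _; rewrite ?normr1 ?normr0.
rewrite exprS mxE (le_trans (ler_norm_sum _ _ _))//.
apply: (@le_trans _ _ (\sum_(l < n) `|B| * (n%:R * `|B|) ^+ k)).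
  apply: ler_sum => l _; rewrite normrM; apply: ler_pM => //.
  exact: mx_entry_le_norm.
by rewrite sumr_const card_ord exprS -mulrA -[leLHS]mulr_natl.
Qed.

Lemma expr_scalemx (R : comNzRingType) n (t : R) (B : 'M[R]_n) k :
  (t *: B) ^+ k = t ^+ k *: B ^+ k.
Proof.
elim: k => [|k IH]; first by rewrite !expr0 scale1r.
rewrite !exprS IH .
have mulE (C D : 'M[R]_n) : C * D = C *m D by [].
by rewrite !mulE -scalemxAl -scalemxAr scalerA.
Qed.

Section Expmx.
Context (R : realType) (n : nat) (B : 'M[R]_n).

(* Entry (i, j) of [expmx (t *: B)] is the power series with these
   coefficients, evaluated at t. *)
Let coef i j (k : nat) : R := (k`!%:R)^-1 * (B ^+ k) i j.

Let coef_diffs i j k :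
  pseries_diffs (coef i j) k = (k`!%:R)^-1 * (B ^+ k.+1) i j.
Proof.
by rewrite /pseries_diffs /coef factS natrM invfM mulrA mulrA divff ?mul1r.
Qed.

Let is_cvg_entries (c : R^nat) (m : nat) (x : R) :
  (forall k, `|c k| <= (k`!%:R)^-1 * (n%:R * `|B|) ^+ (k + m)) ->
  cvgn (pseries c x).
Proof.
move=> cb; apply: normed_cvg.
set b : R := n%:R * `|B|.
have -> : [normed pseries c x] = series (fun k => `|c k * x ^+ k|) by [].
apply: (@series_le_cvg _ _ (b ^+ m *: exp_coeff (b * `|x|))) => [k|k|k|] //.
- by rewrite mulr_ge0 ?exprn_ge0 ?exp_coeff_ge0 ?mulr_ge0.
- rewrite /= normrM normrX.
  apply: (le_trans (ler_wpM2r _ (cb k))); first by rewrite exprn_ge0.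
  rewrite -/b.
  have -> : (b ^+ m *: exp_coeff (b * `|x|)) k =
      b ^+ m * ((b * `|x|) ^+ k / k`!%:R) by [].
  suff -> : b ^+ m * ((b * `|x|) ^+ k / k`!%:R) =
      (k`!%:R)^-1 * b ^+ (k + m) * `|x| ^+ k by [].
  by rewrite (exprMn k b) exprD; ring.
- by apply: is_cvg_seriesZ; exact: is_cvg_series_exp_coeff.
Qed.

Let is_cvg_coef i j x : cvgn (pseries (coef i j) x).
Proof.
apply: (@is_cvg_entries _ 0) => k; rewrite addn0 normrM ger0_norm ?invr_ge0//.
by rewrite ler_wpM2l ?invr_ge0 ?expr_mx_entry_le.
Qed.

Let is_cvg_coef_diffs i j x : cvgn (pseries (pseries_diffs (coef i j)) x).
Proof.
apply: (@is_cvg_entries _ 1) => k; rewrite coef_diffs normrM.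
rewrite ger0_norm ?invr_ge0// addn1.
by rewrite ler_wpM2l ?invr_ge0 ?expr_mx_entry_le.
Qed.

Let is_cvg_coef_diffs2 i j x :
  cvgn (pseries (pseries_diffs (pseries_diffs (coef i j))) x).
Proof.
apply: (@is_cvg_entries _ 2) => k.
rewrite /pseries_diffs -/(pseries_diffs _ _) coef_diffs factS natrM invfM.
rewrite mulrA mulrA divff ?mul1r ?pnatr_eq0//.
rewrite normrM ger0_norm ?invr_ge0// addn2.
by rewrite ler_wpM2l ?invr_ge0 ?expr_mx_entry_le.
Qed.

Let partial_sum_entry t i j :
  (fun N => series (fun k => (k`!%:R)^-1 *: (t *: B) ^+ k) N i j) =
  pseries (coef i j) t.
Proof.
apply/funext => N; rewrite /pseries /series/= summxE; apply: eq_bigr => m _.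
by rewrite expr_scalemx !mxE /coef mulrCA mulrC.
Qed.

Lemma cvg_expmx (t : R) :
  series (fun k => (k`!%:R)^-1 *: (t *: B) ^+ k) @ \oo --> expmx (t *: B).
Proof.
suff : cvgn (series (fun k => (k`!%:R)^-1 *: (t *: B) ^+ k)) by [].
apply/cvg_ex; exists (\matrix_(i, j) limn (pseries (coef i j) t)).
by apply/cvg_mxP => i j; rewrite mxE partial_sum_entry; exact: is_cvg_coef.
Qed.

Let expmx_entry t i j : expmx (t *: B) i j = limn (pseries (coef i j) t).
Proof.
have /cvg_mxP/(_ i j) := @cvg_expmx t.
by rewrite partial_sum_entry => /cvg_lim <-.
Qed.

Lemma expmx_comm t : expmx (t *: B) *m B = B *m expmx (t *: B).
Proof.
pose S := series (fun k => (k`!%:R)^-1 *: (t *: B) ^+ k).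
have SE : S N @[N --> \oo] --> expmx (t *: B) by exact: cvg_expmx.
have SB : S N *m B @[N --> \oo] --> expmx (t *: B) *m B.
  by apply: cvg_mulmx => //; exact: cvg_cst.
have BS : B *m S N @[N --> \oo] --> B *m expmx (t *: B).
  by apply: cvg_mulmx => //; exact: cvg_cst.
rewrite -(cvg_lim (@norm_hausdorff _ _) SB) -(cvg_lim (@norm_hausdorff _ _) BS).
congr (limn _); apply/funext => N; rewrite /S /series/= mulmx_suml mulmx_sumr.
apply: eq_bigr => k _; rewrite expr_scalemx -!scalemxAl -!scalemxAr.
by congr (_ *: (_ *: _)); rewrite -[RHS]exprS -[LHS]exprSr.
Qed.

(** Each entry is a power series in [t] dominated by an exponential series,
hence may be differentiated term by term. *)
Lemma is_derive_expmx (t : R) :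
  is_derive t 1 (fun s => expmx (s *: B)) (B *m expmx (t *: B)).
Proof.
apply/is_derive_mxP => i j.
have -> : (fun s => expmx (s *: B) i j) = fun s => limn (pseries (coef i j) s).
  by apply/funext => s; rewrite expmx_entry.
have tK : `|t| < `| `|t| + 1 |.
  by rewrite (ger0_norm (addr_ge0 (normr_ge0 t) ler01)) ltrDl.
have := @pseries_snd_diffs R (coef i j) (`|t| + 1) t (@is_cvg_coef i j _)
  (@is_cvg_coef_diffs i j _) (@is_cvg_coef_diffs2 i j _) tK.
set D := limn _; suff -> : D = (B *m expmx (t *: B)) i j by [].
apply/cvg_lim => //; rewrite mxE.
have -> : pseries (pseries_diffs (coef i j)) t =
    fun N => \sum_k B i k * pseries (coef k j) t N.
  apply/funext => N; rewrite /pseries /series/=.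
  under [RHS]eq_bigr do rewrite big_distrr/=.
  rewrite exchange_big/=; apply: eq_bigr => m _.
  rewrite coef_diffs exprS mxE big_distrr/= big_distrl/=.
  by apply: eq_bigr => k _; rewrite /coef; ring.
apply: cvg_big => [|k _]; first exact: add_continuous.
by rewrite expmx_entry; apply: cvgMr; exact: is_cvg_coef.
Qed.

Lemma expmx0 : expmx (0 *: B) = 1%:M.
Proof.
apply/matrixP => i j; rewrite expmx_entry.
apply/cvg_lim => //; apply: (@cvg_near_cst _ _ _ _ eventually).
exists 1%N => // -[//|N] _.
rewrite /pseries /series/= big_nat_recl//= big1 ?addr0 => [|k _].
  by rewrite /coef invr1 mul1r !expr0 mulr1.
by rewrite expr0n mulr0.
Qed.

End Expmx.

Lemma is_derive_expmx_comp (R : realType) n (B : 'M[R]_n) (g : R -> R)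
    (t dg : R) :
  is_derive t 1 g dg ->
  is_derive t 1 (fun s => expmx (g s *: B)) (dg *: (B *m expmx (g t *: B))).
Proof.
move=> gD; apply/is_derive_mxP => i j.
have /is_derive_mxP/(_ i j) D := is_derive_expmx B (g t).
have := @is_derive1_comp R (fun u => expmx (u *: B) i j) g t _ _ D gD.
by rewrite mulrC [in X in _ -> X]mxE.
Qed.

Lemma continuous_expmx (R : realType) n (B : 'M[R]_n) :
  continuous (fun s : R => expmx (s *: B)).
Proof.
move=> t; apply: differentiable_continuous; apply/derivable1_diffP.
by case: (is_derive_expmx B t).
Qed.

Lemma constant_of_is_derive0 (R : realType) (f : R -> R) (a b : R) :
  a <= b -> {within `[a, b], continuous f} ->
  (forall t, a < t < b -> is_derive t 1 f 0) -> f b = f a.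
Proof.
move=> ab fc fD; apply/eqP; rewrite -subr_eq0; apply/eqP.
have fD' t : t \in `]a, b[%R -> is_derive t 1 f 0 by rewrite in_itv/=; exact: fD.
by have [c _ ->] := MVT_segment ab fD' fc; rewrite mul0r.
Qed.

Lemma linear_ode_unique (R : realType) n q (B : 'M[R]_n)
    (phi : R -> 'M[R]_(n, q)) (a b : R) :
  a <= b -> {within `[a, b], continuous phi} ->
  (forall t, a < t < b -> is_derive t 1 phi (B *m phi t)) ->
  phi b = expmx ((b - a) *: B) *m phi a.
Proof.
move=> ab phic phiD.
(* Transporting phi s to time b along the flow gives a constant function of s:
   its derivative cancels because B commutes with its exponential. *)
pose psi s := expmx ((b - s) *: B) *m phi s.
have E_D (s : R) : is_derive s 1 (fun s => expmx ((b - s) *: B))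
    (- (B *m expmx ((b - s) *: B))).
  have Dg : is_derive s 1 (fun u : R => b - u) (-1).
    by apply: is_derive_eq; rewrite add0r mul1r.
  by have := is_derive_expmx_comp B Dg; rewrite scaleN1r.
have psiD (t : R) : a < t < b -> is_derive t 1 psi 0.
  move=> /phiD phiDt; have := is_derive_mulmx (E_D t) phiDt.
  by rewrite mulmxA expmx_comm mulNmx addrC subrr.
have Ec : continuous (fun s => expmx ((b - s) *: B)).
  move=> s; apply: differentiable_continuous; apply/derivable1_diffP.
  by case: (E_D s).
have psic : {within `[a, b], continuous psi}.
  move=> s; apply: cvg_mulmx; last exact: phic.
  exact: (continuous_subspaceT Ec).
have psiab : psi b = psi a.
  apply/matrixP => i j.
  apply: (@constant_of_is_derive0 _ (fun s => psi s i j)) => //.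
    by move=> s; move/cvg_mxP: (psic s); apply.
  by move=> t /psiD/is_derive_mxP/(_ i j); rewrite mxE.
by have := psiab; rewrite /psi subrr expmx0 mul1mx.
Qed.

(** Both sides solve the same linear equation in [s], with the same value
at [0]. *)
Lemma expmxD (R : realType) n (B : 'M[R]_n) (s t : R) : 0 <= s ->
  expmx ((s + t) *: B) = expmx (s *: B) *m expmx (t *: B).
Proof.
move=> s0; have tst : t <= s + t by rewrite lerDr.
have := @linear_ode_unique _ _ _ B (fun u => expmx (u *: B)) t (s + t) tst.
rewrite addrK; apply; first exact: continuous_subspaceT (@continuous_expmx _ _ B).
by move=> u _; exact: is_derive_expmx.
Qed.

Lemma expmx_bounded_on_segment (R : realType) n (B : 'M[R]_n) (T : R) :
  exists K, forall s, 0 <= s <= T -> `|expmx (s *: B)| <= K.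
Proof.
have [T0|T0] := leP 0 T; last first.
  by exists 0 => s /andP[s0 sT]; have := lt_le_trans T0 (le_trans s0 sT); rewrite ltxx.
have c : {within `[0, T], continuous (fun s => `|expmx (s *: B)|)}.
  apply: continuous_subspaceT => s.
  exact: (cvg_norm (@continuous_expmx _ _ B s)).
have [u _ uP] := EVT_max T0 c.
by exists `|expmx (u *: B)| => s sT; apply: uP; rewrite in_itv.
Qed.

(** * Norms on a finite-dimensional space *)

Lemma is_norm0 (R : realType) (V : lmodType R) (v : V -> R) : is_norm v -> v 0 = 0.
Proof. by case=> _ vZ _; rewrite -(scale0r 0) vZ normr0 mul0r. Qed.

Lemma is_norm_opp (R : realType) (V : lmodType R) (v : V -> R) x :
  is_norm v -> v (- x) = v x.
Proof. by case=> _ vZ _; rewrite -scaleN1r vZ normrN1 mul1r. Qed.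

Lemma is_norm_ge0 (R : realType) (V : lmodType R) (v : V -> R) x :
  is_norm v -> 0 <= v x.
Proof.
move=> nv; have [vD _ _] := nv.
by have := vD x (- x); rewrite subrr (is_norm0 nv) (is_norm_opp _ nv) -mulr2n
  pmulrn_lge0.
Qed.

Lemma is_norm_sum (R : realType) (V : lmodType R) (v : V -> R) m
    (f : 'I_m -> V) : is_norm v -> v (\sum_i f i) <= \sum_i v (f i).
Proof.
move=> nv; have [vD _ _] := nv; elim/big_rec2 : _ => [|i y z _ le_yz].
  by rewrite (is_norm0 nv).
by rewrite (le_trans (vD _ _))// lerD2l.
Qed.

Lemma is_norm_dist (R : realType) (V : lmodType R) (v : V -> R) x y :
  is_norm v -> `|v x - v y| <= v (x - y).
Proof.
move=> nv; have [vD _ _] := nv; rewrite ler_norml; apply/andP; split.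
  by have := vD (y - x) x; rewrite subrK -(is_norm_opp (y - x) nv) opprB; lra.
by have := vD (x - y) y; rewrite subrK; lra.
Qed.

Section NormEquivalence.
Context (R : realType) (n : nat) (v : 'cV[R]_n -> R).
Hypothesis nv : is_norm v.

Lemma is_norm_le_mx_norm : exists2 C, 0 <= C & forall x, v x <= C * `|x|.
Proof.
have [_ vZ _] := nv.
exists (\sum_i v (delta_mx i 0)) => [|x].
  by apply: sumr_ge0 => i _; exact: is_norm_ge0.
have {1}-> : x = \sum_i x i 0 *: delta_mx i 0.
  rewrite [LHS]matrix_sum_delta; apply: eq_bigr => i _.
  by rewrite big_ord1.
rewrite (le_trans (is_norm_sum _ nv))// big_distrl/=; apply: ler_sum => i _.
by rewrite vZ mulrC ler_wpM2l ?is_norm_ge0 ?mx_entry_le_norm.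
Qed.

Lemma is_norm_continuous : continuous v.
Proof.
have [C C0 vC] := is_norm_le_mx_norm => x.
have xF := nbhs_filter x; apply/(@cvgrPdist_le _ _ _ _ xF) => e e0.
have C1 : 0 < C + 1 by rewrite ltr_wpDl.
have xx : z @[z --> x] --> x by exact: cvg_id.
have /(@cvgrPdist_le _ _ _ _ xF)/(_ (e / (C + 1))) := xx; rewrite divr_gt0// => /(_ isT).
apply: filterS => y xy.
rewrite (le_trans (is_norm_dist _ _ nv))// (le_trans (vC _))//.
rewrite (@le_trans _ _ ((C + 1) * `|x - y|)) ?ler_wpM2r ?lerDl//.
by rewrite mulrC -ler_pdivlMr.
Qed.

(** A norm is continuous, hence attains on the compact unit sphere a minimum,
which is positive; homogeneity does the rest. Compactness is available for
row vectors, whence the transpositions. *)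
Lemma mx_norm_le_is_norm : exists2 C, 0 <= C & forall x, `|x| <= C * v x.
Proof.
have [_ vZ v_eq0] := nv.
pose S := [set y : 'rV[R]_n | `|y| = 1].
have norm_tr p q (x : 'M[R]_(p, q)) : `|x^T| = `|x|.
  apply/eqP; rewrite eq_le; apply/andP; split.
    rewrite [leLHS]/Num.Def.normr/= mx_normrE bigmax_le// => ij _.
    by rewrite mxE mx_entry_le_norm.
  rewrite [leLHS]/Num.Def.normr/= mx_normrE bigmax_le// => ij _.
  by have := mx_entry_le_norm x^T ij.2 ij.1; rewrite mxE.
(* The unit sphere is empty exactly when n is 0. *)
have [S0|/set0P S0] := eqVneq S set0.
  exists 0 => // x; rewrite mul0r leNgt; apply/negP => x0.
  suff : S (`|x|^-1 *: x)^T by rewrite S0.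
  by rewrite /S/= norm_tr normrZ normfV normr_id mulVf// gt_eqF.
have Sc : compact S.
  apply: bounded_closed_compact.
    by exists 1; split => // M M1 y /= ->; exact: ltW.
  rewrite (_ : S = Num.norm @^-1` [set 1])//; apply: closed_comp => [y _|].
    exact: norm_continuous.
  exact: closed_eq.
have vc : {within S, continuous (fun y : 'rV[R]_n => v y^T)}.
  apply: continuous_subspaceT => y.
  apply: (@continuous_comp _ _ _ (fun y : 'rV[R]_n => y^T) v).
    apply/(@cvg_mxP _ _ _ _ _ (nbhs_filter y)) => i j; rewrite mxE.
    by under eq_cvg do rewrite mxE; exact: coord_continuous.
  exact: is_norm_continuous.
have [c cS cmin] := compact_EVT_min S0 Sc vc.
have vc0 : 0 < v c^T.
  rewrite lt_neqAle is_norm_ge0// andbT eq_sym; apply/eqP => /v_eq0 c0.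
  move: cS; rewrite inE /S/= -norm_tr c0 normr0 => /eqP.
  by rewrite eq_sym oner_eq0.
exists (v c^T)^-1 => [|x]; first by rewrite invr_ge0 ltW.
rewrite mulrC ler_pdivlMr//.
have [->|x0] := eqVneq x 0; first by rewrite normr0 mul0r is_norm_ge0.
have nx : 0 < `|x| by rewrite normr_gt0.
have := cmin (`|x|^-1 *: x)^T.
rewrite inE /S/= norm_tr normrZ normfV normr_id mulVf ?gt_eqF// => /(_ erefl).
by rewrite trmxK vZ normfV normr_id mulrC ler_pdivlMr// mulrC.
Qed.

End NormEquivalence.

Lemma is_norm_equiv (R : realType) n (v w : 'cV[R]_n -> R) :
  is_norm v -> is_norm w -> exists2 C, 0 <= C & forall x, v x <= C * w x.
Proof.
move=> /is_norm_le_mx_norm[C C0 vC] /mx_norm_le_is_norm[D D0 wD].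
exists (C * D) => [|x]; first exact: mulr_ge0.
by rewrite (le_trans (vC x))// -mulrA ler_wpM2l.
Qed.

Lemma expmx_norm_bounded (R : realType) n M (A : 'I_M -> 'M[R]_n)
    (v : 'cV[R]_n -> R) (T : R) : is_norm v ->
  exists2 K, 0 <= K & forall i s x, 0 <= s <= T ->
    v (expmx (s *: A i) *m x) <= K * v x.
Proof.
move=> nv.
have [C C0 vC] := is_norm_le_mx_norm nv.
have [D D0 vD] := mx_norm_le_is_norm nv.
have /choice[k kP] : forall i, exists K, forall s, 0 <= s <= T ->
    `|expmx (s *: A i)| <= K by move=> i; exact: expmx_bounded_on_segment.
exists (C * (n%:R * (\sum_i `|k i|) * D)) => [|i s x sT].
  by rewrite !mulr_ge0// sumr_ge0.
rewrite (le_trans (vC _))// -mulrA ler_wpM2l//.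
rewrite [leLHS]/Num.Def.normr/= mx_normrE bigmax_le// => [|[l l'] _].
  by rewrite !mulr_ge0//; [exact: sumr_ge0|exact: is_norm_ge0].
rewrite mxE (le_trans (ler_norm_sum _ _ _))//.
apply: (@le_trans _ _ (\sum_(j < n) (\sum_i `|k i|) * (D * v x))); last first.
  by rewrite sumr_const card_ord -!mulrA [leRHS]mulr_natl.
apply: ler_sum => j _; rewrite normrM ler_pM//.
  rewrite (le_trans (mx_entry_le_norm _ _ _))// (le_trans (kP i s sT))//.
  rewrite (bigD1 i)//= (le_trans (ler_norm _))// lerDl sumr_ge0//.
by rewrite (le_trans _ (vD x))// mx_entry_le_norm.
Qed.

(** * Signals given by switching instants and modes *)

Section Follows.
Context (R : realType) (M : nat).
Implicit Types (sigma : R -> 'I_M) (T : nat -> R) (m : nat -> 'I_M).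

(** The [T k.+1] are the switching instants when, moreover, consecutive modes
differ; see [follows_switching_instant]. *)
Definition follows sigma T m : Prop :=
  [/\ T 0%N = 0, forall k, T k < T k.+1, forall t, exists k, t < T k
    & forall k t, T k <= t < T k.+1 -> sigma t = m k].

Lemma instants_le T : (forall k, T k < T k.+1) ->
  {homo T : k l / (k <= l)%N >-> k <= l}.
Proof.
move=> T_lt; apply: homo_leq => [x|y x z xy|k]; first exact: lexx.
  exact: le_trans xy.
exact: ltW.
Qed.

Lemma instants_lt T : (forall k, T k < T k.+1) ->
  {homo T : k l / (k < l)%N >-> k < l}.
Proof.
by move=> T_lt k l kl; apply: (lt_le_trans (T_lt k)); exact: instants_le.
Qed.

Lemma instants_locate T t : T 0%N <= t -> (exists k, t < T k) ->
  exists k, T k <= t < T k.+1.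
Proof.
move=> T0t /ex_minnP[[|k]]; first by rewrite ltNge T0t.
by move=> tk kmin; exists k; rewrite tk andbT leNgt; apply/negP => /kmin; rewrite ltnn.
Qed.

Lemma follows_exists T m : T 0%N = 0 -> (forall k, T k < T k.+1) ->
  (forall t, exists k, t < T k) -> exists sigma, follows sigma T m.
Proof.
move=> T0 T_lt T_unbounded.
have /choice[idx idxP] : forall t, exists k, T 0%N <= t -> T k <= t < T k.+1.
  move=> t; have [T0t|] := boolP (T 0%N <= t); last by exists 0%N.
  by have [k kt] := instants_locate T0t (T_unbounded t); exists k.
exists (m \o idx); split => // k t /andP[kt tk] /=; congr m.
have /idxP/andP[it ti] : T 0%N <= t by apply: le_trans kt; exact: instants_le.
apply/eqP; rewrite eqn_leq; apply/andP; split; rewrite leqNgt; apply/negP.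
  by move=> /(instants_le T_lt)/(lt_le_trans tk)/lt_le_trans/(_ it); rewrite ltxx.
by move=> /(instants_le T_lt)/(lt_le_trans ti)/lt_le_trans/(_ kt); rewrite ltxx.
Qed.

Section Properties.
Context sigma T m (H : follows sigma T m).

Let T_lt k : T k < T k.+1. Proof. by case: H. Qed.

Lemma follows_ge0 k : 0 <= T k.
Proof. by case: (H) => <- _ _ _; exact: instants_le. Qed.

Lemma follows_locate t : 0 <= t -> exists k, T k <= t < T k.+1.
Proof.
case: (H) => T0 _ T_unbounded _ t0.
by apply: instants_locate (T_unbounded t); rewrite T0.
Qed.

Lemma follows_instant k : sigma (T k) = m k.
Proof. by case: (H) => _ _ _; apply; rewrite lexx T_lt. Qed.

Lemma follows_near k t : T k < t < T k.+1 -> \forall s \near t, sigma s = m k.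
Proof.
move=> /andP[kt tk]; case: (H) => _ _ _ sm; near=> s; apply: sm.
by apply/andP; split; near: s; [exact: lt_le_nbhsr|exact: lt_nbhsl].
Unshelve. all: by end_near. Qed.

Hypothesis m_switch : forall k, m k != m k.+1.

Lemma follows_discontinuities t :
  discontinuities sigma t <-> exists k, t = T k.+1.
Proof.
case: (H) => T0 _ _ sm; split=> [[t0 nt]|[k ->]].
  have [k /andP[kt tk]] := follows_locate (ltW t0).
  have [kt'|] := eqVneq (T k) t.
    case: k kt' {kt tk} => [|k kt]; last by exists k.
    by rewrite T0 => t00; move: t0; rewrite -t00 ltxx.
  move=> nkt; case: nt; rewrite (sm _ _ (introT andP (conj kt tk))).
  by apply: follows_near; rewrite lt_neqAle nkt kt.
split; first by apply: le_lt_trans (T_lt k); exact: follows_ge0.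
move=> near_cst; suff mk : m k = m k.+1 by have := m_switch k; rewrite mk eqxx.
rewrite follows_instant in near_cst.
have : \forall s \near (T k.+1)^'-, m k = m k.+1.
  near=> s; transitivity (sigma s).
    apply/esym/sm; apply/andP; split; last by near: s; exact: nbhs_left_lt.
    by near: s; exact: nbhs_left_ge.
  by near: s; apply: cvg_within near_cst.
by move=> /filter_ex[].
Unshelve. all: by end_near. Qed.

Lemma follows_is_signal : is_signal sigma.
Proof.
case: (H) => T0 _ T_unbounded sm; split=> [t t0|u].
  have [k /andP[kt tk]] := follows_locate t0.
  rewrite (sm k t) ?kt//; near=> s; apply: sm; apply/andP; split.
    by apply: (le_trans kt); near: s; exact: nbhs_right_ge.
  by near: s; exact: nbhs_right_lt.
have [N uN] := T_unbounded u.
apply: (@sub_finite_set _ _ (T @` `I_N)); last exact/finite_image/finite_II.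
move=> t [/follows_discontinuities[k ->]]; rewrite /= in_itv/= => /andP[_ ku].
exists k.+1 => //=; rewrite ltnNge; apply/negP => /(instants_le T_lt).
by move=> /(lt_le_trans uN)/lt_le_trans/(_ ku); rewrite ltxx.
Unshelve. all: by end_near. Qed.

Lemma follows_switching_instant k : switching_instant sigma k = (T k)%:E.
Proof.
elim: k => [|k IH]; first by case: (H) => /= ->.
rewrite /= IH; apply/eqP; rewrite eq_le; apply/andP; split.
  apply: ereal_inf_lbound; exists (T k.+1) => //; split; last by rewrite lte_fin.
  by apply/follows_discontinuities; exists k.
apply: le_ereal_inf_tmp => _ [s [/follows_discontinuities[l ->] +] <-].
rewrite lte_fin lee_fin => kl; apply: instants_le => //.
rewrite ltnS leqNgt; apply/negP => /(instants_le T_lt).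
by move=> /(lt_le_trans kl); rewrite ltxx.
Qed.

Lemma follows_dwell tau1 tau2 :
  (forall k, tau1 <= T k.+1 - T k <= tau2) -> dwell_signals tau1 tau2 sigma.
Proof.
move=> Td; split=> [|k]; first exact: follows_is_signal.
by rewrite !follows_switching_instant -EFinB !lee_fin; apply/andP.
Qed.

End Properties.

Lemma finite_set_min (X : set R) : finite_set X -> X !=set0 ->
  exists2 a, X a & forall x, X x -> a <= x.
Proof.
move=> /finite_seqP[s ->]; elim: s => [[x]//|y s IH] _.
have [s0|/set0P/IH[a /= sa amin]] := eqVneq [set` s] set0.
  exists y => /=; rewrite ?mem_head// => x; rewrite inE => /orP[/eqP->//|xs].
  by have : [set` s] x by []; rewrite s0.
exists (Num.min y a) => [|x] /=; rewrite inE.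
  by case: leP => _; [rewrite eqxx|rewrite sa orbT].
by move=> /orP[/eqP->|/amin ax]; rewrite ge_min ?lexx// ax orbT.
Qed.

(** Between two consecutive discontinuities the indicator of a mode is locally
constant, so that its derivative vanishes: the mean value theorem stands in
for the connectedness of the interval. *)
Lemma signal_constant sigma (a b : R) : is_signal sigma -> 0 <= a -> a <= b ->
  (forall t, a < t <= b -> ~ discontinuities sigma t) -> sigma b = sigma a.
Proof.
move=> [sr _] a0 ab nd; apply/eqP; apply: contraT => sab.
have {}ab : a < b.
  by rewrite lt_neqAle ab andbT; apply: contraNneq sab => ->.
pose f t : R := (sigma t == sigma a)%:R.
have near_cst t : a < t <= b -> \forall s \near t, f t = f s.
  move=> tab; have t0 : 0 < t by apply: le_lt_trans a0 _; case/andP: tab.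
  have /not_andP[//|/contrapT] := nd t tab.
  by apply: filterS => s st; rewrite /f st.
have fD t : a < t < b -> is_derive t 1 f 0.
  move=> /andP[at' tb]; apply: (near_eq_is_derive (f := cst (f t))).
  by apply: near_cst; rewrite at' ltW.
have fc : {within `[a, b], continuous f}.
  apply/continuous_within_itvP => //; split.
  - move=> t; rewrite in_itv/= => /andP[at' tb].
    apply: cvg_near_cst; apply: filterS (near_cst t _) => [s ->//|].
    by rewrite at' ltW.
  - apply: cvg_near_cst; apply: filterS (sr a a0) => s sa.
    by rewrite /f sa.
  - apply: cvg_near_cst; apply: cvg_within.
    by apply: filterS (near_cst b _) => [s ->//|]; rewrite ab lexx.
have := constant_of_is_derive0 (ltW ab) fc fD.
by rewrite /f eqxx (negbTE sab) => /eqP; rewrite eq_sym oner_eq0.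
Qed.

(** The upper bound on the dwell times makes every switching instant finite. By
local finiteness each one is attained as a discontinuity, and they cannot
accumulate. *)
Lemma dwell_follows tau1 tau2 sigma : dwell_signals tau1 tau2 sigma ->
  exists T m, [/\ follows sigma T m, forall k, m k != m k.+1
    & forall k, tau1 <= T k.+1 - T k <= tau2].
Proof.
move=> [sig dw]; have [sr sf] := sig.
have fin k : switching_instant sigma k \is a fin_num.
  elim: k => [//|k IH]; have := dw k; move: IH.
  set x := switching_instant sigma k.+1; case: (switching_instant sigma k) => //.
  by move=> r _; case: x => //= -[].
pose T k := fine (switching_instant sigma k).
have TE k : switching_instant sigma k = (T k)%:E by rewrite fineK.
have step k : [/\ discontinuities sigma (T k.+1), T k < T k.+1 &
    forall t, discontinuities sigma t -> T k < t -> T k.+1 <= t].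
  pose X := [set s | discontinuities sigma s /\ T k < s].
  have XT : (T k.+1)%:E = ereal_inf [set s%:E | s in X].
    rewrite -TE /=; congr ereal_inf; congr image; apply/funext => s.
    by rewrite /X /mkset TE lte_fin.
  have [s0 Xs0] : X !=set0.
    apply/set0P/eqP => X0; move: XT; rewrite X0 image_set0 ereal_inf0.
    by [].
  have [||a [Xa as0] amin] := @finite_set_min (X `&` `[0, s0]).
  - apply: sub_finite_set (sf s0) => s [[ds _]]; by split.
  - exists s0; split => //=; rewrite in_itv/= lexx andbT ltW//.
    by case: Xs0 => -[].
  have aT : T k.+1 = a.
    apply: EFin_inj; rewrite XT; apply/eqP; rewrite eq_le; apply/andP; split.
      by apply: ereal_inf_lbound; exists a.
    apply: le_ereal_inf_tmp => _ [s Xs <-]; rewrite lee_fin.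
    have [ss0|/ltW s0s] := leP s s0.
      by apply: amin; split => //=; rewrite in_itv/= ss0 andbT ltW//; case: Xs => -[].
    by apply: le_trans s0s; move: as0; rewrite /= in_itv/= => /andP[].
  rewrite aT; split; [by case: Xa|by case: Xa|move=> t dt kt].
  rewrite -aT -lee_fin XT; apply: ereal_inf_lbound.
  by exists t.
have T_lt k : T k < T k.+1 by case: (step k).
have T0 : T 0%N = 0 by [].
have T_ge0 k : 0 <= T k by rewrite -T0; exact: instants_le.
have T_unbounded t : exists k, t < T k.
  apply: contrapT => /forallNP Tt; apply: infinite_nat.
  have -> : [set: nat] = (fun k => T k.+1) @^-1` (discontinuities sigma `&` `[0, t]).
    apply/esym; rewrite -subTset => k _; split; first by case: (step k).
    by rewrite /= in_itv/= T_ge0 leNgt; apply/negP.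
  apply: finite_preimage (sf t) => k l _ _ kl.
  apply: contrapT => /eqP; rewrite neq_ltn => /orP[]; rewrite -ltnS => /(instants_lt T_lt);
    by rewrite kl ltxx.
have const k t : T k <= t < T k.+1 -> sigma t = sigma (T k).
  move=> /andP[kt tk]; apply: signal_constant => // s /andP[ks st] ds.
  have [_ _ /(_ s ds ks)] := step k.
  by move=> /(le_lt_trans)/(_ (le_lt_trans st tk)); rewrite ltxx.
exists T, (sigma \o T); split=> [|k|k].
- by split.
- have [[Tk0 nd] _ _] := step k; apply/eqP => /= eqs; apply: nd.
  have r := sr _ (ltW Tk0).
  near=> s; have [sT|Ts|->//] := ltgtP s (T k.+1).
    rewrite -eqs; apply: const; rewrite sT andbT.
    by near: s; exact: lt_le_nbhsr.
  by move: Ts; near: s.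
- have := dw k; rewrite !TE -EFinB !lee_fin => -[-> ->] //.
Unshelve. all: by end_near. Qed.

End Follows.

(** * Solutions of the switched system *)

Section Solutions.
Context (R : realType) (n M : nat) (A : 'I_M -> 'M[R]_n).
Context (sigma : R -> 'I_M) (T : nat -> R) (m : nat -> 'I_M).
Hypothesis H : follows sigma T m.

Let T_lt k : T k < T k.+1. Proof. by case: H. Qed.

Lemma solution_step x phi k t : is_solution A sigma x phi ->
  T k <= t <= T k.+1 ->
  phi t = expmx ((t - T k) *: A (m k)) *m phi (T k).
Proof.
move=> [_ phic phiD] /andP[kt tk]; apply: linear_ode_unique => //.
  apply: continuous_subspaceW phic => s /=; rewrite !in_itv/= andbT => /andP[ks _].
  by apply: le_trans ks; exact: follows_ge0 H k.
move=> s /andP[ks st].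
have ksk : T k < s < T k.+1 by rewrite ks (lt_le_trans st).
have sk : sigma s = m k.
  by case: H => _ _ _; apply; case/andP: ksk => /ltW -> ->.
rewrite -sk; apply: phiD; first exact: (le_lt_trans (follows_ge0 H k) ks).
by move=> [_]; apply; rewrite sk; exact: (follows_near H ksk).
Qed.

Hypothesis m_switch : forall k, m k != m k.+1.

Let elapsed (k : nat) (t : R) : R := Num.min (Num.max (t - T k) 0) (T k.+1 - T k).

Let elapsed_continuous k : continuous (elapsed k).
Proof.
move=> t; apply: (@continuous_min R R (fun t => Num.max (t - T k) 0) (cst _)).
  apply: (@continuous_max R R (fun t => t - T k) (cst 0)); last exact: cvg_cst.
  by apply: cvgB; [exact: cvg_id|exact: cvg_cst].
exact: cvg_cst.
Qed.

Let elapsed_before k t : t <= T k -> elapsed k t = 0.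
Proof.
move=> tk; rewrite /elapsed max_r ?subr_le0// min_l// subr_ge0 ltW//.
Qed.

Let elapsed_during k t : T k <= t <= T k.+1 -> elapsed k t = t - T k.
Proof.
by move=> /andP[kt tk]; rewrite /elapsed max_l ?subr_ge0// min_l// lerD2r.
Qed.

Let elapsed_after k t : T k.+1 <= t -> elapsed k t = T k.+1 - T k.
Proof.
move=> kt; rewrite /elapsed max_l ?min_r ?lerD2r// subr_ge0.
by apply: le_trans kt; exact: ltW.
Qed.

Let stage (x : 'cV[R]_n) := fix stage (N : nat) (t : R) : 'cV[R]_n :=
  if N is k.+1 then expmx (elapsed k t *: A (m k)) *m stage k t else x.

Let stage_continuous x N : continuous (stage x N).
Proof.
elim: N => [|N IH] t /=; first exact: cvg_cst.
apply: cvg_mulmx; last exact: IH.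
apply: (@continuous_comp _ _ _ (elapsed N) (fun s => expmx (s *: A (m N)))).
  exact: elapsed_continuous.
exact: continuous_expmx.
Qed.

Let stage_stable x N N' t : (N <= N')%N -> t <= T N -> stage x N' t = stage x N t.
Proof.
move=> NN' tN; elim: N' NN' => [|N' IH]; first by rewrite leqn0 => /eqP ->.
rewrite leq_eqVlt => /orP[/eqP ->//|NN']; rewrite -IH//=.
rewrite elapsed_before ?expmx0 ?mul1mx//.
by apply: le_trans tN _; exact: instants_le.
Qed.

Let stage_frozen x N t : T N <= t -> stage x N t = stage x N (T N).
Proof.
elim: N t => [//|N IH] t Nt /=; rewrite !elapsed_after//.
by rewrite IH ?(IH (T N.+1))// ltW// (lt_le_trans (T_lt N)).
Qed.

(** The solution is glued from the products [stage x N], in which mode [m k]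
has run for the time spent in [[T k, T k.+1]] before [t]. Clamping this time
makes each product continuous on the whole line, and [stage x N t] no longer
depends on [N] once [t <= T N]. *)
Lemma solution_exists x : exists phi, is_solution A sigma x phi.
Proof.
have [T0 _ T_unbounded sm] := H.
have /choice[N NP] : forall t, exists k, t < T k by exact: T_unbounded.
pose phi t := stage x (N t) t.
have phiE k t : t <= T k -> phi t = stage x k t.
  move=> tk; rewrite /phi; have [Nk|/ltnW kN] := leqP (N t) k.
    by rewrite (stage_stable x Nk)// ltW.
  exact: stage_stable.
exists phi; split.
- by rewrite (phiE 0%N) ?T0.
- apply: continuous_subspaceT => t.
  have E : \forall s \near t, stage x (N t) s = phi s.
    near=> s; rewrite (phiE (N t))//; near: s; exact: lt_le_nbhsl.
  apply: cvg_trans (near_eq_cvg E) _.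
  by rewrite (phiE (N t)) ?ltW//; exact: stage_continuous.
- move=> t t0 ndt; have [k /andP[kt tk]] := follows_locate H (ltW t0).
  have {}kt : T k < t.
    rewrite lt_neqAle kt andbT; apply/eqP => kt'; apply: ndt.
    apply/(follows_discontinuities H m_switch).
    case: k kt' {kt tk} => [|k <-]; last by exists k.
    by rewrite T0 => t00; move: t0; rewrite -t00 ltxx.
  rewrite (sm k t) ?(ltW kt)//.
  pose psi s := expmx ((s - T k) *: A (m k)) *m stage x k (T k).
  have E s : T k <= s <= T k.+1 -> psi s = phi s.
    move=> /andP[ks sk]; rewrite (phiE k.+1)//= elapsed_during ?ks//.
    by rewrite stage_frozen.
  rewrite -E ?(ltW kt) ?(ltW tk)//.
  apply: (near_eq_is_derive (f := psi)).
    near=> s; apply: E; apply/andP; split; near: s.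
      exact: lt_le_nbhsr.
    exact: lt_le_nbhsl.
  have shiftD : is_derive t 1 (fun s => expmx ((s - T k) *: A (m k)))
      (A (m k) *m expmx ((t - T k) *: A (m k))).
    have Dg : is_derive t 1 (fun u : R => u - T k) 1.
      by apply: is_derive_eq; rewrite subr0.
    by have := is_derive_expmx_comp (A (m k)) Dg; rewrite scale1r.
  have := is_derive_mulmx shiftD (is_derive_cst (stage x k (T k)) t 1).
  by rewrite mulmx0 addr0 -mulmxA.
Unshelve. all: by end_near. Qed.

Fixpoint transition (m : nat -> 'I_M) (d : nat -> R) (k : nat) : 'M[R]_n :=
  if k is k'.+1 then expmx (d k' *: A (m k')) *m transition m d k' else 1%:M.

Lemma solution_transition x phi k t : is_solution A sigma x phi ->
  T k <= t <= T k.+1 ->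
  phi t = expmx ((t - T k) *: A (m k)) *m
    (transition m (fun l => T l.+1 - T l) k *m x).
Proof.
move=> phis kt; rewrite (solution_step phis kt); congr (_ *m _).
elim: k {t kt} => [|k IH].
  by rewrite mul1mx; case: H => -> _ _ _; case: phis.
by rewrite (@solution_step _ _ k _ phis) ?lexx ?ltW// IH mulmxA.
Qed.

End Solutions.

(** * Dwell norms give exponential stability *)

(** Along a solution the norm [vm] of the active mode, read at the switching
instants, decreases at rate [alpha]: a dwell time in [[tau1, tau2]] splits
into a part of length at most [tau2 - tau1], controlled by the first family
of inequalities, and a final part [tau1], controlled by the second one.
Between switching instants the state grows at most by a constant factor. *)
Lemma dwell_norms_stable (R : realType) (n M : nat) (nrm : 'cV[R]_n -> R)
    (A : 'I_M -> 'M[R]_n) (tau1 tau2 alpha : R) :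
  is_norm nrm -> 0 <= tau1 -> has_dwell_norms A tau1 tau2 alpha ->
  exp_stable_with_decay nrm A (dwell_signals tau1 tau2) alpha.
Proof.
move=> nn tau10 [vm [vp [vn v_free v_dwell]]].
have [K K0 KP] := expmx_norm_bounded A tau2 nn.
have /choice[c cP] : forall i, exists c, 0 <= c /\ forall x, nrm x <= c * vm i x.
  by move=> i; have [c c0 cP] := is_norm_equiv nn (vn i).1; exists c.
have /choice[c' c'P] : forall i, exists c, 0 <= c /\ forall x, vm i x <= c * nrm x.
  by move=> i; have [c0 c00 c0P] := is_norm_equiv (vn i).1 nn; exists c0.
have le_sum (u : 'I_M -> R) i : (forall j, 0 <= u j) -> u i <= \sum_j u j.
  by move=> u0; rewrite (bigD1 i)//= lerDl sumr_ge0.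
have c0 i : 0 <= c i by case: (cP i).
have c'0 i : 0 <= c' i by case: (c'P i).
set C1 := \sum_i c i; set C2 := \sum_i c' i.
have C10 : 0 <= C1 by exact: sumr_ge0.
have C20 : 0 <= C2 by exact: sumr_ge0.
have nrm_vm i x : nrm x <= C1 * vm i x.
  apply: (le_trans ((cP i).2 x)); rewrite ler_wpM2r ?is_norm_ge0 ?le_sum//.
  by case: (vn i).
have vm_nrm i x : vm i x <= C2 * nrm x.
  by apply: (le_trans ((c'P i).2 x)); rewrite ler_wpM2r ?is_norm_ge0 ?le_sum.
exists (K * C1 * C2 * expR (`|alpha| * tau2)) => [|sigma x phi t].
  by rewrite !mulr_ge0 ?expR_ge0.
move=> /dwell_follows[T [m [H m_switch Td]]] phis t0.
have [k /andP[kt tk]] := follows_locate H t0.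
have T_lt : forall k, T k < T k.+1 by case: H.
have decay l : vm (m l) (phi (T l)) <= expR (- alpha * T l) * vm (m 0%N) x.
  elim: l => [|l IH].
    by case: H => -> _ _ _; case: phis => -> _ _; rewrite mulr0 expR0 mul1r.
  have /andP[dl1 dl2] := Td l; set r := T l.+1 - T l - tau1.
  have r_range : 0 <= r <= tau2 - tau1 by rewrite subr_ge0 dl1 lerD2r.
  have ll : T l <= T l.+1 <= T l.+1 by rewrite lexx ltW.
  rewrite (solution_step H phis ll).
  have -> : T l.+1 - T l = tau1 + r by rewrite /r; ring.
  rewrite expmxD// -mulmxA (le_trans (v_dwell _ _ _ (m_switch l)))//.
  have -> : expR (- alpha * T l.+1) = expR (- alpha * tau1) *
      (expR (- alpha * r) * expR (- alpha * T l)).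
    by rewrite -!expRD; congr expR; rewrite /r; ring.
  rewrite -!mulrA ler_wpM2l ?expR_ge0// (le_trans (v_free _ _ _ r_range))//.
  by rewrite ler_wpM2l ?expR_ge0.
have kk : T k <= t <= T k.+1 by rewrite kt ltW.
rewrite (solution_step H phis kk).
have s_range : 0 <= t - T k <= tau2.
  rewrite subr_ge0 kt; have /andP[_] := Td k; apply: le_trans.
  by rewrite lerD2r ltW.
rewrite (le_trans (KP _ _ _ s_range))// -!mulrA ler_wpM2l//.
rewrite (le_trans (nrm_vm (m k) _))// ler_wpM2l//.
apply: (le_trans (decay k)).
apply: le_trans (ler_wpM2l (expR_ge0 _) (vm_nrm _ x)) _.
rewrite mulrCA ler_wpM2l// mulrA ler_wpM2r ?is_norm_ge0// -expRD ler_expR.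
have -> : - alpha * T k = alpha * (t - T k) + - alpha * t by ring.
rewrite lerD2r (le_trans (ler_norm _))// normrM ler_wpM2l//.
by case/andP: s_range => s0 s2; rewrite ger0_norm.
Qed.

(** * Exponential stability gives dwell norms *)

Section Converse.
Context (R : realType) (n M : nat) (nrm : 'cV[R]_n -> R).
Context (A : 'I_M -> 'M[R]_n) (tau1 tau2 : R).
Hypothesis nn : is_norm nrm.
Hypothesis tau1_ge0 : 0 <= tau1.
Hypothesis tau12 : tau1 <= tau2.

(** [schedule b i t B] holds when [B] is a product of exponentials, of total
duration [t], along a finite sequence of activations starting in mode [i].
With [b = false] mode [i] has just been entered; with [b = true] the
optional part of its dwell time, of length at most [tau2 - tau1], is over and
the mandatory part [tau1] comes next. *)
Inductive schedule : bool -> 'I_M -> R -> 'M[R]_n -> Prop :=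
| ScheduleStop b i : schedule b i 0 1%:M
| ScheduleFree i r t B : 0 <= r <= tau2 - tau1 -> schedule true i t B ->
    schedule false i (t + r) (B *m expmx (r *: A i))
| ScheduleDwell i j t B : i != j -> schedule false j t B ->
    schedule true i (t + tau1) (B *m expmx (tau1 *: A i)).

Lemma schedule_ge0 b i t B : schedule b i t B -> 0 <= t.
Proof. by elim=> // {}i {}t ? ? => [/andP[r0 _]|] *; rewrite addr_ge0. Qed.

(** [B] is the transition matrix at time [t] of an infinite sequence of
activations whose durations respect the dwell bounds. If [tau1 = 0] some
durations may vanish, in which case this is not yet an admissible signal. *)
Definition realized (i : 'I_M) (t : R) (B : 'M[R]_n) : Prop :=
  exists m d N s, [/\ m 0%N = i, forall k, m k != m k.+1,
    forall k, tau1 <= d k <= tau2, 0 <= s <= d N &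
    t = \sum_(k < N) d k + s /\
    B = expmx (s *: A (m N)) *m transition A m d N].

Lemma alternating_modes (i : 'I_M) : (forall i : 'I_M, exists j, i != j) ->
  exists m : nat -> 'I_M, m 0%N = i /\ forall k, m k != m k.+1.
Proof. by move=> /choice[f fP]; exists (fun k => iter k f i). Qed.

Lemma realized_start i r : (forall i : 'I_M, exists j, i != j) ->
  0 <= r <= tau2 - tau1 -> realized i r (expmx (r *: A i)).
Proof.
move=> /(alternating_modes i)[m [m0 m_switch]] /andP[r0 rd].
exists m, (fun=> tau1 + r), 0%N, r; split=> //.
- by move=> _; rewrite lerDl r0 -lerBrDl.
- by rewrite r0 lerDr.
- by rewrite big_ord0 add0r mulmx1 m0.
Qed.

Lemma realized_cons i j r t B : i != j -> 0 <= r <= tau2 - tau1 ->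
  realized j t B ->
  realized i (t + tau1 + r) (B *m expmx ((tau1 + r) *: A i)).
Proof.
move=> ij /andP[r0 rd] [m [d [N [s [m0 m_switch dP sP [-> ->]]]]]].
pose m' k := if k is k'.+1 then m k' else i.
pose d' k := if k is k'.+1 then d k' else tau1 + r.
exists m', d', N.+1, s; split=> //.
- by case=> [|k] //=; rewrite m0.
- by case=> [|k] //=; rewrite lerDl r0 -lerBrDl.
- rewrite big_ord_recl/=; split; first by ring.
  rewrite -mulmxA; congr (_ *m _); elim: N {sP} => [|N IH] /=.
    by rewrite mul1mx mulmx1.
  by rewrite -mulmxA IH.
Qed.

(** A schedule with [b = true] starts in the middle of an activation: only
together with a free part [r] before it does it begin a signal. *)
Lemma schedule_realized b i t B : (forall i : 'I_M, exists j, i != j) ->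
  schedule b i t B ->
  if b then forall r, 0 <= r <= tau2 - tau1 ->
    realized i (t + r) (B *m expmx (r *: A i))
  else realized i t B.
Proof.
move=> two; elim=> {b i t B} [[] i|i r t B rP _|i j t B ij _ IH r rP].
- by move=> r rP; rewrite add0r mul1mx; exact: realized_start.
- by rewrite -(expmx0 (A i)); apply: realized_start => //; rewrite lexx subr_ge0.
- exact.
- rewrite -mulmxA -expmxD//; exact: realized_cons ij rP IH.
Qed.

Lemma cvg_transition (m : nat -> 'I_M) (f : R -> nat -> R) (d : nat -> R) N
    (F : set_system R) : Filter F ->
  (forall k, f e k @[e --> F] --> d k) ->
  transition A m (f e) N @[e --> F] --> transition A m d N.
Proof.
move=> FF fd; elim: N => [|N IH] /=; first exact: cvg_cst.
apply: cvg_mulmx; last exact: IH.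
exact: (cvg_comp _ _ (fd N) (@continuous_expmx _ _ (A (m N)) (d N))).
Qed.

Section Stable.
Context (rho : R).
Hypothesis stable : exp_stable_with_decay nrm A (dwell_signals tau1 tau2) rho.

(** Durations that vanish are not those of a signal. Replacing each duration
[d k] by [max (d k) e] with [0 < e <= tau2] gives an admissible signal, for
which the estimate holds, and the estimate passes to the limit [e -> 0]. *)
Lemma realized_bounded : 0 < tau2 -> exists2 C, 0 <= C &
  forall i t B x, realized i t B ->
    nrm (B *m x) <= C * expR (- rho * t) * nrm x.
Proof.
move=> tau2_gt0; have [C C0 CP] := stable; exists C => // i t B x.
move=> [m [d [N [s [m0 m_switch dP /andP[s0 sd] [-> ->]]]]]].
pose dd e k := Num.max (d k) e.
have ddP e : 0 < e <= tau2 -> nrm (expmx (s *: A (m N)) *m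
    transition A m (dd e) N *m x) <=
    C * expR (- rho * (\sum_(k < N) dd e k + s)) * nrm x.
  move=> /andP[e0 e2].
  pose T N := \sum_(k < N) dd e k.
  have TS k : T k.+1 - T k = dd e k by rewrite /T big_ord_recr/= addrAC subrr add0r.
  have T0 : T 0%N = 0 by rewrite /T big_ord0.
  have dde k : e <= dd e k by rewrite /dd le_max lexx orbT.
  have T_lt k : T k < T k.+1.
    by rewrite -subr_gt0 TS; exact: lt_le_trans (dde k).
  have T_unbounded u : exists k, u < T k.
    have T_ge k : k%:R * e <= T k.
      elim: k => [|k IH]; first by rewrite T0 mul0r.
      by rewrite -(subrK (T k) (T k.+1)) TS -natr1 mulrDl mul1r addrC lerD.
    exists (Num.truncn (u / e)).+1; apply: lt_le_trans (T_ge _).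
    by rewrite -ltr_pdivrMr// truncnS_gt.
  have [sigma H] := follows_exists m T0 T_lt T_unbounded.
  (* max (d k) e still lies in [tau1, tau2], because e <= tau2. *)
  have sd' : sigma \in dwell_signals tau1 tau2.
    rewrite inE; apply: (follows_dwell H m_switch) => k; rewrite TS /dd.
    have /andP[d1 d2] := dP k.
    by rewrite le_max d1/= ge_max d2 e2.
  have [phi phis] := solution_exists A H m_switch x.
  have Ns : T N <= T N + s <= T N.+1.
    by rewrite lerDl s0 -lerBrDl TS (le_trans sd)// /dd le_max lexx.
  have ddE : (fun l => T l.+1 - T l) = dd e by apply/funext => l; rewrite TS.
  have := solution_transition H phis Ns.
  rewrite addrAC subrr add0r mulmxA ddE => <-.
  apply: CP phis _; first by move: sd'; rewrite inE.
  by rewrite addr_ge0// (follows_ge0 H).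
have dd0 k : dd e k @[e --> 0^'+] --> d k.
  have {1}<- : Num.max (d k) 0 = d k.
    by rewrite max_l//; have /andP[+ _] := dP k; exact: le_trans.
  apply: cvg_at_right_filter.
  exact: (@continuous_max R R (cst (d k)) id 0 (cvg_cst _) (@cvg_id _ _)).
have lhs : nrm (expmx (s *: A (m N)) *m transition A m (dd e) N *m x)
    @[e --> 0^'+] --> nrm (expmx (s *: A (m N)) *m transition A m d N *m x).
  apply: continuous_cvg; first exact: is_norm_continuous.
  apply: cvg_mulmx; last exact: cvg_cst.
  by apply: cvg_mulmx; [exact: cvg_cst|exact: cvg_transition].
have rhs : C * expR (- rho * (\sum_(k < N) dd e k + s)) * nrm x
    @[e --> 0^'+] --> C * expR (- rho * (\sum_(k < N) d k + s)) * nrm x.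
  apply: cvgMl; apply: cvgMr.
  apply: continuous_cvg; first exact: continuous_expR.
  apply: cvgMr; apply: cvgD; last exact: cvg_cst.
  by apply: cvg_big => [|k _]; [exact: add_continuous|exact: dd0].
apply: (ler_cvg_to lhs rhs); near=> e; apply: ddP; apply/andP; split; near: e.
  exact: nbhs_right_gt.
exact: nbhs_right_le.
Unshelve. all: by end_near. Qed.

(** A schedule extends to an infinite sequence of activations as soon as every
mode can be left and [tau2 > 0]. Otherwise no signal is admissible and the
hypothesis is void, but then a schedule amounts to running one mode for at
most [tau2]. *)
Lemma schedule_bounded : exists2 C, 0 <= C & forall b i t B x, schedule b i t B ->
  nrm (B *m x) <= C * expR (- rho * t) * nrm x.
Proof.
have [[two tau2_gt0]|degenerate] :=
    pselect ((forall i : 'I_M, exists j, i != j) /\ 0 < tau2).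
  have [C C0 CP] := realized_bounded tau2_gt0; exists C => // -[] i t B x;
    move=> /(schedule_realized two); last exact: CP.
  move=> /(_ 0); rewrite lexx subr_ge0 expmx0 mulmx1 addr0 => /(_ tau12).
  exact: CP.
have [K K0 KP] := expmx_norm_bounded A tau2 nn.
exists (K * expR (`|rho| * tau2)) => [|b i t B x p].
  by rewrite mulr_ge0 ?expR_ge0.
have tau2_ge0 : 0 <= tau2 by exact: le_trans tau12.
suff [ts ->] : (0 <= t <= tau2) /\ B = expmx (t *: A i).
  rewrite (le_trans (KP _ _ _ ts))// -!mulrA ler_wpM2l// mulrA -expRD.
  rewrite -[leLHS]mul1r ler_wpM2r ?is_norm_ge0// -expR0 ler_expR.
  case/andP: ts => t0 t2; rewrite mulNr subr_ge0.
  rewrite (le_trans (ler_norm _))// normrM (ger0_norm t0) ler_wpM2l//.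
have [tau2_gt0|tau2_le0] := ltP 0 tau2.
- have one (j k : 'I_M) : j = k.
    apply: contrapT => /eqP jk; apply: degenerate; split=> // l.
    by have [<-|] := eqVneq j l; [exists k|exists j; rewrite eq_sym].
  have stop l s D : schedule true l s D -> s = 0 /\ D = 1%:M.
    move=> q; inversion q => //; subst.
    by have := one l j => lj; rewrite lj eqxx in H.
  case: p => {b i t B} [b i|i r t B /andP[r0 rd] /stop[-> ->]|i j].
  + by rewrite lexx tau2_ge0 expmx0.
  + rewrite add0r mul1mx r0 (le_trans rd)// gerBl//.
  + by move=> t B; rewrite (one i j) eqxx.
- have tau2_0 : tau2 = 0 by apply/eqP; rewrite eq_le tau2_le0.
  have tau1_0 : tau1 = 0 by apply/eqP; rewrite eq_le tau1_ge0 -tau2_0 tau12.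
  suff [-> ->] : t = 0 /\ B = 1%:M by rewrite lexx tau2_ge0 expmx0.
  elim: p => {b i t B} [//|i r t B|i j t B _ _ [-> ->]].
    rewrite tau1_0 tau2_0 subrr => /le_anti <- _ [-> ->].
    by rewrite expmx0 addr0 mulmx1.
  by rewrite tau1_0 expmx0 addr0 mulmx1.
Qed.

Context (alpha : R).
Hypothesis alpha_le : alpha <= rho.

(* V false and V true are the required norms v^- and v^+: the worst weighted
   size that a schedule can give to the state. *)
Let costs b i x :=
  [set c | exists t B, schedule b i t B /\ c = expR (alpha * t) * nrm (B *m x)].

Let V b i x := sup (costs b i x).

Let costs_sup b i x : has_sup (costs b i x).
Proof.
split.
  exists (expR (alpha * 0) * nrm (1%:M *m x)), 0, 1%:M; split=> //.
  exact: ScheduleStop.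
have [C C0 CP] := schedule_bounded; exists (C * nrm x) => _ [t [B [p ->]]].
apply: (le_trans (ler_wpM2l (expR_ge0 _) (CP _ _ _ _ x p))).
rewrite mulrA ler_wpM2r ?is_norm_ge0// mulrCA -expRD.
rewrite -[leRHS]mulr1 ler_wpM2l// -expR0 ler_expR -mulrDl.
by rewrite mulr_le0_ge0 ?(schedule_ge0 p)// subr_le0.
Qed.

Let V_ub b i x t B : schedule b i t B -> expR (alpha * t) * nrm (B *m x) <= V b i x.
Proof.
by move=> p; apply: sup_upper_bound; [exact: costs_sup|exists t, B].
Qed.

Let V_lub b i x c :
  (forall t B, schedule b i t B -> expR (alpha * t) * nrm (B *m x) <= c) -> V b i x <= c.
Proof.
move=> cP; apply: ge_sup; first by case: (costs_sup b i x).
by move=> _ [t [B [p ->]]]; exact: cP.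
Qed.

Let V_norm b i : is_norm (V b i).
Proof.
have [nD nZ n_eq0] := nn.
have V_ge x : nrm x <= V b i x.
  by have := V_ub x (ScheduleStop b i); rewrite mulr0 expR0 mul1r mul1mx.
have V_scale a x : V b i (a *: x) <= `|a| * V b i x.
  apply: V_lub => t B p; rewrite -scalemxAr nZ mulrCA ler_wpM2l//.
  exact: V_ub.
split=> [x y|a x|x Vx].
- apply: V_lub => t B p; rewrite mulmxDr.
  apply: (le_trans (ler_wpM2l (expR_ge0 _) (nD _ _))).
  by rewrite mulrDr lerD// V_ub.
- apply/eqP; rewrite eq_le V_scale/=.
  have [->|a0] := eqVneq a 0.
    by rewrite normr0 mul0r (le_trans _ (V_ge _))// is_norm_ge0.
  have := V_scale a^-1 (a *: x); rewrite scalerA mulVf// scale1r normfV.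
  by rewrite mulrC ler_pdivlMr ?normr_gt0// mulrC.
- by apply: n_eq0; apply/eqP; rewrite eq_le is_norm_ge0// -Vx V_ge.
Qed.

(** Prepending a step to a schedule gives a schedule, so that the suprema [V]
satisfy both families of inequalities by construction. *)
Lemma stable_dwell_norms : has_dwell_norms A tau1 tau2 alpha.
Proof.
have step r i t B x : expR (alpha * t) * nrm (B *m (expmx (r *: A i) *m x)) =
    expR (- alpha * r) *
      (expR (alpha * (t + r)) * nrm (B *m expmx (r *: A i) *m x)).
  by rewrite mulmxA [RHS]mulrA -expRD; congr (expR _ * _); ring.
exists (V false), (V true); split=> [i|i r x rP|i j x ij].
- by split; exact: V_norm.
- apply: V_lub => t B p; rewrite step ler_wpM2l ?expR_ge0//.
  by apply: V_ub; exact: ScheduleFree.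
- apply: V_lub => t B p; rewrite step ler_wpM2l ?expR_ge0//.
  by apply: V_ub; exact: ScheduleDwell ij p.
Qed.

End Stable.
End Converse.

(** * The decay rate *)

Lemma ereal_pos_between (R : realFieldType) (x y : \bar R) :
  (0 < y)%E -> (x < y)%E -> exists2 r : R, 0 < r & (x < r%:E < y)%E.
Proof.
case: y => [y||] //; rewrite ?lte_fin => y0; case: x => [x||] // xy.
- rewrite lte_fin in xy; exists ((Num.max x 0 + y) / 2); rewrite ?lte_fin;
    case: (leP x 0) => x0; lra.
- by exists (y / 2); rewrite ?ltNyr ?lte_fin; lra.
- exists (Num.max x 0 + 1); rewrite ?ltry ?lte_fin ?andbT; case: (leP x 0) => x0; lra.
- by exists 1; rewrite ?ltNyr ?ltry.
Qed.

Theorem corollary1 (R : realType) (n M : nat) (nrm : 'cV[R]_n -> R)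
    (A : 'I_M -> 'M[R]_n) (tau1 tau2 : R) (rho : \bar R) :
  is_norm nrm -> 0 <= tau1 -> tau1 <= tau2 -> (0 < rho)%E ->
  rho = exp_decay_rate nrm A (dwell_signals tau1 tau2) <->
  (forall alpha : R, (alpha%:E < rho)%E -> has_dwell_norms A tau1 tau2 alpha) /\
  (forall rho' : \bar R,
     (forall alpha : R, (alpha%:E < rho')%E ->
        has_dwell_norms A tau1 tau2 alpha) ->
     (rho' <= rho)%E).
Proof.
move=> nn tau1_ge0 tau12 rho_gt0.
(* Above 0 the decays of the estimate and the alpha that admit norms have the
   same supremum, and both conditions say that rho is this supremum. *)
set rate := exp_decay_rate nrm A (dwell_signals tau1 tau2).
have norms_below alpha : (alpha%:E < rate)%E -> has_dwell_norms A tau1 tau2 alpha.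
  move=> /ereal_sup_gt[_ [r [_ stable] <-]]; rewrite lte_fin => /ltW.
  exact: stable_dwell_norms stable _.
have rate_ge alpha : 0 < alpha -> has_dwell_norms A tau1 tau2 alpha ->
    (alpha%:E <= rate)%E.
  move=> alpha0 norms; apply: ereal_sup_ubound; exists alpha => //; split=> //.
  exact: dwell_norms_stable norms.
have le_rate x : (0 < x)%E ->
    (forall alpha : R, (alpha%:E < x)%E -> has_dwell_norms A tau1 tau2 alpha) ->
    (x <= rate)%E.
  move=> x0 norms; rewrite leNgt; apply/negP => rate_x.
  have [alpha alpha0 /andP[rate_alpha alpha_x]] := ereal_pos_between x0 rate_x.
  by have := rate_ge _ alpha0 (norms _ alpha_x); rewrite leNgt rate_alpha.
split=> [rhoE|[norms rho_max]]; last first.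
  by apply/eqP; rewrite eq_le le_rate// rho_max.
split=> [alpha|x norms]; rewrite rhoE; first exact: norms_below.
have [x0|x0] := ltP 0%E x; first exact: le_rate.
by rewrite (le_trans x0)// -rhoE ltW.
Qed.
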